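(* Let $m,n\geq 3$ be integers and $D=\overrightarrow{C}_m[\overrightarrow{C}_n]$. For any harmonious coloring of $D$ with $k$ colors, \[k\geq \min\{\max\{f_n(x),g_n(x)\}: x\in\mathbb{N},\ x\geq 1\},\] where $f_n(x)=\lceil mn/x\rceil$ and $g_n(x)=x(n+1)+1$.
   Context: $\overrightarrow{C}_m$ is the directed cycle with vertex set $\mathbb{Z}_m$ and arcs $j\to j+1$. The lexicographic product $D[H]$ has vertex set $V(D)\times V(H)$, with an arc from $(u,a)$ to $(v,b)$ iff $uv\in A(D)$, or $u=v$ and $ab\in A(H)$. A coloring with $k$ colors is a surjection $V(D)\to[k]$ that is proper (each color class spans no arc); it is harmonious if for every ordered pair $(i,j)$ of distinct colors there is at most one arc from a vertex colored $i$ to a vertex colored $j$. *)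

(* Defs.v *)
From mathcomp Require Import all_boot all_order all_algebra.
From mathcomp Require Import boolp.

Set Implicit Arguments.
Unset Strict Implicit.
Unset Printing Implicit Defensive.

Import GRing.Theory.

(* A finite digraph is given by its arc relation on a finType of vertices. *)

(* Meant for m >= 2: in mathcomp, 'Z_0 and 'Z_1 are both Z/2. *)
Definition dcycle (m : nat) : rel 'Z_m := fun i j => j == (i + 1)%R.

Definition lexprod (V W : finType) (D : rel V) (H : rel W) : rel (V * W) :=
  fun p q => D p.1 q.1 || ((p.1 == q.1) && H p.2 q.2).

Section Coloring.
Variables (V : finType) (D : rel V) (k : nat) (c : V -> 'I_k).

Definition proper_coloring : Prop :=
  (forall i : 'I_k, exists v, c v = i) /\
  (forall u v, D u v -> c u <> c v).

Definition arcs_between (i j : 'I_k) : {set V * V} :=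
  [set a | [&& D a.1 a.2, c a.1 == i & c a.2 == j]].

Definition harmonious_coloring : Prop :=
  proper_coloring /\
  (forall i j : 'I_k, i != j -> #|arcs_between i j| <= 1).
End Coloring.

Lemma posvalues_nonempty (F : nat -> nat) :
  exists v, `[< exists2 x, 1 <= x & v = F x >].
Proof. by exists (F 1); apply/asboolP; exists 1. Qed.

(* min {F x : x in nat, x >= 1} *)
Definition minpos (F : nat -> nat) : nat := ex_minn (posvalues_nonempty F).

(* The ceiling is an int, nonnegative here, so absz is a mere cast to nat. *)
Definition fn (m n x : nat) : nat :=
  absz (Num.ceil ((m * n)%N%:R / x%:R : rat)%R).

Definition gn (n x : nat) : nat := x * (n + 1) + 1.

(* Main.v *)
Require Import Defs.
From mathcomp Require Import all_boot all_order all_algebra.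
From mathcomp Require Import boolp.

Set Implicit Arguments.
Unset Strict Implicit.
Unset Printing Implicit Defensive.

Import Order.TTheory GRing.Theory Num.Theory.

(** Let [x] be the size of a largest color class. The [k] classes cover the
    [m * n] vertices, so [m * n <= k * x]. Every vertex has [n + 1]
    out-neighbors, and the [x * (n + 1)] arcs leaving a largest class end in
    pairwise distinct colors, all different from its own, so
    [x * (n + 1) <= k - 1]. Hence the minimum is at most its value at [x]. *)

Lemma minpos_le (F : nat -> nat) (x : nat) : 1 <= x -> minpos F <= F x.
Proof.
move=> x_gt0; rewrite /minpos; case: ex_minnP => v _; apply.
by apply/asboolP; exists x.
Qed.

Lemma fn_le (m n x k : nat) : 0 < x -> m * n <= k * x -> fn m n x <= k.
Proof.
move=> x_gt0 le_mn; rewrite /fn.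
have xQ_gt0 : (0 < x%:R :> rat)%R by rewrite ltr0n.
have ceil_ge0 : (0 <= Num.ceil ((m * n)%N%:R / x%:R : rat))%R.
  (* A ceiling is nonnegative exactly when its argument exceeds [-1]; the quotient does, being
     nonnegative. *)
  by rewrite ceil_ge0 (@lt_le_trans _ _ 0%R) ?ltrN10 ?divr_ge0 ?ler0n.
rewrite -lez_nat gez0_abs // ceil_le_int ler_pdivrMr //.
by rewrite -pmulrn -natrM ler_nat.
Qed.

Lemma card_Z (n : nat) : 1 < n -> #|{: 'Z_n}| = n.
Proof. by move=> n_gt1; rewrite card_ord Zp_cast. Qed.

(** The vertex [(u, a)] dominates the whole copy over [u + 1], which gives [n], and the single
    vertex [(u, a + 1)] of its own copy. *)
Lemma outdegree_lexprod_dcycle (m n : nat) (p : 'Z_m * 'Z_n) : 1 < n ->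
  #|[set q | lexprod (@dcycle m) (@dcycle n) p q]| = n + 1.
Proof.
case: p => u a n_gt1.
have -> : [set q | lexprod (@dcycle m) (@dcycle n) (u, a) q] =
    setX [set (u + 1)%R] [set: 'Z_n] :|: [set (u, (a + 1)%R)].
  apply/setP => -[v b]; rewrite !inE /lexprod /dcycle /= andbT xpair_eqE.
  by rewrite (eq_sym u v).
rewrite cardsU cardsX !cards1 cardsT card_Z // mul1n.
(* A common vertex would force [u + 1 = u], but [1 != 0] in ['Z_m]. *)
have -> : setX [set (u + 1)%R] [set: 'Z_n] :&: [set (u, (a + 1)%R)] = set0.
  apply/setP => -[v b]; rewrite !inE andbT xpair_eqE /=.
  have [->|//] := eqVneq v (u + 1)%R.
  by rewrite -[X in _ == X]addr0 (inj_eq (addrI u)) oner_eq0.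
by rewrite cards0 subn0.
Qed.

Section ColorClass.
Variables (V : finType) (D : rel V) (k : nat) (c : V -> 'I_k).

Definition color_class (i : 'I_k) : {set V} := [set v | c v == i].

Lemma card_color_classes : #|V| = \sum_(i < k) #|color_class i|.
Proof.
rewrite -sum1_card (partition_big c predT) //=.
by apply: eq_bigr => i _; rewrite -sum1_card; apply: eq_bigl => v; rewrite inE.
Qed.

(** Properness makes the tail and head colors distinct, so both arcs lie in one set [arcs_between]
    with at most one element. *)
Lemma harmonious_arc_unique (u v u' v' : V) : harmonious_coloring D c ->
  D u v -> D u' v' -> c u = c u' -> c v = c v' -> (u, v) = (u', v').
Proof.
move=> [[_ properD] arcs_le1] Duv Duv' cu cv.
have /arcs_le1/card_le1_eqP : c u != c v by apply/eqP; apply: properD.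
by apply; rewrite inE /= ?Duv ?Duv' -?cu -?cv !eqxx.
Qed.

Lemma color_class_outdegree (d : nat) (i : 'I_k) : harmonious_coloring D c ->
  (forall u, #|[set v | D u v]| = d) -> #|color_class i| * d + 1 <= k.
Proof.
move=> harmD outdeg.
pose A : {set V * V} := [set a | (c a.1 == i) && D a.1 a.2].
have cardA : #|A| = #|color_class i| * d.
  rewrite -sum_nat_const -sum1_card.
  (* Count the arcs of [A] by their tail [u]: those starting at [u] are the image of its
     out-neighborhood under [pair u]. *)
  rewrite (partition_big fst (mem (color_class i))) /=; last first.
    by move=> [u v]; rewrite !inE => /andP[].
  apply: eq_bigr => u; rewrite inE => cu; rewrite -(outdeg u) sum1_card.
  rewrite -(card_imset [set v | D u v] (f := pair u)); last by move=> ? ? [].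
  apply: eq_card => -[u' v]; rewrite unfold_in /= inE /=; apply/idP/imsetP.
    by case/andP => /andP[_ Duv] /eqP eu; exists v; rewrite ?inE -eu.
  by case=> w; rewrite inE => Duw [-> ->]; rewrite cu Duw eqxx.
have head_inj : {in A &, injective (fun a : V * V => c a.2)}.
  move=> [u v] [u' v']; rewrite !inE /=.
  move=> /andP[/eqP cu Duv] /andP[/eqP cu' Duv'].
  by apply: harmonious_arc_unique => //; rewrite cu cu'.
have headA : [set c a.2 | a in A] \subset [set~ i].
  apply/subsetP => j /imsetP[[u v]]; rewrite !inE /= => /andP[/eqP <- Duv] ->.
  by apply/eqP => /esym; apply: harmD.1.2.
have := subset_leq_card headA; rewrite card_in_imset // cardA cardsC1 card_ord.
(* The colors other than [i] number [k.-1]; the color [i] itself witnesses [0 < k], so the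
   predecessor is not truncated. *)
by rewrite addn1 -ltnS prednK // (leq_ltn_trans _ (ltn_ord i)).
Qed.

End ColorClass.

Theorem theorem10 (m n : nat) (hm : 3 <= m) (hn : 3 <= n)
    (k : nat) (c : 'Z_m * 'Z_n -> 'I_k) :
  harmonious_coloring (lexprod (@dcycle m) (@dcycle n)) c ->
  minpos (fun x => maxn (fn m n x) (gn n x)) <= k.
Proof.
(* The color [i0] is in use, so the largest class is nonempty and its size is an admissible
   [x >= 1]. *)
move=> harmc; pose i0 := c (0%R, 0%R).
pose i := [arg max_(j > i0) #|color_class c j|].
have max_i j : #|color_class c j| <= #|color_class c i|.
  by rewrite /i; case: arg_maxnP => // i' _; apply.
have class_gt0 : 0 < #|color_class c i|.
  apply: leq_trans (max_i i0).
  by apply/card_gt0P; exists (0%R, 0%R); rewrite inE.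
have [m_gt1 n_gt1] : 1 < m /\ 1 < n by split; apply: ltnW.
apply: leq_trans (minpos_le _ class_gt0) _; rewrite geq_max; apply/andP; split.
  apply: fn_le => //.
  have <- : #|{: 'Z_m * 'Z_n}| = m * n by rewrite card_prod !card_Z.
  rewrite (card_color_classes c).
  rewrite -[X in X * _]card_ord -sum_nat_const.
  by apply: leq_sum => j _; apply: max_i.
apply: color_class_outdegree harmc _ => u.
exact: outdegree_lexprod_dcycle.
Qed.
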